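(* (1) The collection of all simplified three-dimensional copulas is nowhere dense in $(\mathcal{C}^3,TV)$. (2) The collection of all simplified three-dimensional copulas with positive density is nowhere dense in $(\mathcal{C}^3_{{\rm ac},>0},TV)$.
   Context: $\mathbb{I}=[0,1]$, $\lambda$ Lebesgue measure. $\mathcal{C}^3$ is the set of three-dimensional copulas, $\mu_C$ the probability measure of $C$, and $TV(C_1,C_2)=\sup_{G\in\mathcal{B}(\mathbb{I}^3)}|\mu_{C_1}(G)-\mu_{C_2}(G)|$. Points are written $(\mathbf{u},v)$, $\mathbf{u}=(u_1,u_2)$. For $C\in\mathcal{C}^3$, $K_C$ is (a version of) the regular conditional distribution of $(U_1,U_2)$ given $U_3=v$, $(U_1,U_2,U_3)\sim C$; $F_{1|3}(u_1|t)=K_C(t,[0,u_1]\times\mathbb{I})$, $F_{2|3}(u_2|t)=K_C(t,\mathbb{I}\times[0,u_2])$. $C$ is simplified if there is a bivariate copula $A$ with $C(\mathbf{u},v)=\int_{[0,v]}A(F_{1|3}(u_1|t),F_{2|3}(u_2|t))\,d\lambda(t)$ for all $(\mathbf{u},v)$ and, for $\lambda$-a.e. $t$, $F_{1|3}(\cdot|t)$ and $F_{2|3}(\cdot|t)$ are continuous. $\mathcal{C}^3_{{\rm ac},>0}$ is the set of absolutely continuous three-dimensional copulas with positive density. *)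

(* Defs.v *)
From HB Require Import structures.
From mathcomp Require Import all_boot all_order all_algebra.
From mathcomp Require Import all_classical all_reals all_analysis measurable_realfun.
Set Implicit Arguments. Unset Strict Implicit. Unset Printing Implicit Defensive.
Import Order.TTheory GRing.Theory Num.Theory.
Import numFieldNormedType.Exports.
Local Open Scope classical_set_scope.
Local Open Scope ring_scope.

Section Copulas.
Variable R : realType.

Definition RB := measurableTypeR R.
Definition R3 := ((RB * RB) * RB)%type.
Definition R2 := (RB * RB)%type.

Definition II : set RB := `[0%R, 1%R]%classic.
Definition I3 : set R3 := (II `*` II) `*` II.

(* A three-dimensional copula, identified with its probability measure mu_C:
   a probability measure on R^3 concentrated on I^3 with uniform (Lebesgue)
   one-dimensional marginals on I. *)
Definition is_copula3 (P : probability R3 R) : Prop :=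
  P I3 = 1%E /\
  (forall x : R, 0 <= x <= 1 ->
     [/\ P ((`[0%R, x]%classic `*` setT) `*` setT) = x%:E,
         P ((setT `*` `[0%R, x]%classic) `*` setT) = x%:E &
         P ((setT `*` setT) `*` `[0%R, x]%classic) = x%:E]).

Definition cdf3 (P : probability R3 R) (u1 u2 v : R) : R :=
  fine (P ((`[0%R, u1]%classic `*` `[0%R, u2]%classic) `*` `[0%R, v]%classic)).

Definition TV (P Q : probability R3 R) : \bar R :=
  ereal_sup [set `|(P G - Q G)%E|%E | G in [set G : set R3 | measurable G]].

Definition is_copula2 (A : R -> R -> R) : Prop :=
  (forall u, 0 <= u <= 1 ->
     [/\ A u 0 = 0, A 0 u = 0, A u 1 = u & A 1 u = u]) /\
  (forall u1 u2 v1 v2, 0 <= u1 -> u1 <= u2 -> u2 <= 1 ->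
     0 <= v1 -> v1 <= v2 -> v2 <= 1 ->
     0 <= A u2 v2 - A u2 v1 - A u1 v2 + A u1 v1).

(* K is (a version of) the regular conditional distribution of (U1,U2)
   given U3 = t, where (U1,U2,U3) ~ P (U3 is uniform on I). *)
Definition is_rcd (P : probability R3 R) (K : RB -> probability R2 R) : Prop :=
  (forall B : set R2, measurable B -> measurable_fun [set: RB] ((fun t => K t B) : RB -> \bar R)) /\
  (forall (B : set R2) (A : set RB), measurable B -> measurable A ->
     P (B `*` A) = (\int[lebesgue_measure]_(t in A `&` II) K t B)%E).

Definition F13 (K : RB -> probability R2 R) (u1 : R) (t : RB) : R :=
  fine (K t (`[0%R, u1]%classic `*` II)).
Definition F23 (K : RB -> probability R2 R) (u2 : R) (t : RB) : R :=
  fine (K t (II `*` `[0%R, u2]%classic)).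

Definition simplified (P : probability R3 R) : Prop :=
  exists K : RB -> probability R2 R, is_rcd P K /\
  exists A : R -> R -> R, is_copula2 A /\
    (forall u1 u2 v : R, 0 <= u1 <= 1 -> 0 <= u2 <= 1 -> 0 <= v <= 1 ->
       (cdf3 P u1 u2 v)%:E =
       (\int[lebesgue_measure]_(t in `[0%R, v]%classic)
          (A (F13 K u1 t) (F23 K u2 t))%:E)%E) /\
    {ae lebesgue_measure, forall t : RB, II t ->
       {within II, continuous (fun x : RB => F13 K x t)} /\
       {within II, continuous (fun x : RB => F23 K x t)}}.

Definition leb3 : set R3 -> \bar R :=
  ((@lebesgue_measure R \x @lebesgue_measure R) \x @lebesgue_measure R)%E.

Definition ac_pos (P : probability R3 R) : Prop :=
  exists f : R3 -> R, measurable_fun setT f /\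
    (forall x, I3 x -> 0 < f x) /\
    (forall G : set R3, measurable G -> P G = (\int[leb3]_(x in G) (f x)%:E)%E).

Definition TVclosure (X S : set (probability R3 R)) : set (probability R3 R) :=
  [set C | X C /\ forall e : R, 0 < e -> exists D, S D /\ (TV C D < e%:E)%E].
Definition TVinterior (X A : set (probability R3 R)) : set (probability R3 R) :=
  [set C | X C /\ exists2 e : R, 0 < e &
     forall D, X D -> (TV C D < e%:E)%E -> A D].

Definition nowhere_dense_TV (X S : set (probability R3 R)) : Prop :=
  TVinterior X (TVclosure X S) = set0.

End Copulas.

(* Main.v *)
Require Import Defs.
From HB Require Import structures.
From mathcomp Require Import all_boot all_order all_algebra.
From mathcomp Require Import all_classical all_reals all_analysis measurable_realfun.
From mathcomp Require Import ring lra.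

(* Perturb a simplified copula S, with kernel K, into P = (1 - th) S + th N.
   By pigeonhole there is a set A of positive measure of conditioning values t
   on which the two conditional margins at 1/2 and K_t([0,1/2]^2) vary by at
   most eta. Split A into two parts B1, B2 of positive measure and let N have
   uniform conditional margins, with U1, U2 conditionally independent off B1 but
   in the same half of the unit interval on B1. Then the conditional margins of P
   at 1/2 are still nearly constant on A, whereas the conditional mass of
   [0,1/2]^2 differs by about th/4 between B1 and B2. For a simplified copula D
   close to P the Lipschitz property of its bivariate copula would force those
   two conditional masses to be nearly equal, so no such D exists. *)

Set Implicit Arguments. Unset Strict Implicit. Unset Printing Implicit Defensive.
Import Order.TTheory GRing.Theory Num.Theory.
Import numFieldNormedType.Exports.
Local Open Scope classical_set_scope.
Local Open Scope ring_scope.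

Arguments II {R}.
Arguments I3 {R}.

(** * Level sets of positive measure *)

Lemma measurable_fun_dist_le d (T : measurableType d) (R : realType)
    (f : T -> R) (c eta : R) :
  measurable_fun setT f -> measurable [set t | `|f t - c| <= eta].
Proof.
move=> mf; rewrite -(preimage_itvNyc (fun t => `|f t - c|) eta).
rewrite -[X in measurable X]setTI.
have mn : measurable_fun setT (fun t => `|f t - c|).
  by apply: measurableT_comp => //; exact: measurable_funB.
exact: mn.
Qed.

(** This is the pigeonhole step. Among the nested sets [g i], where [f < i * eta], take the first
    one of positive measure. The one before it is null, so the layer between them has positive
    measure, and [f] varies by less than [eta] on that layer. Any point of the layer serves as
    [t0]. *)
Lemma positive_level_set d (T : measurableType d) (R : realType)
    (mu : {measure set T -> \bar R}) (f : T -> R) (B : set T) (eta : R) :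
  measurable_fun setT f -> (forall t, B t -> 0 <= f t <= 1) -> measurable B ->
  0 < eta -> (0 < mu B)%E ->
  exists2 t0, B t0 & (0 < mu (B `&` [set t | `|f t - f t0| <= eta]%R))%E.
Proof.
move=> mf f01 mB eta0 B0.
pose g (i : nat) := B `&` [set t | f t < i%:R * eta].
have mlt c : measurable [set t | f t < c].
  by rewrite -preimage_itvNyo -[X in measurable X]setTI; exact: mf.
have mg i : measurable (g i) by exact: measurableI.
have gpos : exists i, (0 < mu (g i))%E.
  (* With this index [i * eta] exceeds 1, hence exceeds [f] on all of [B]. *)
  exists (Num.truncn eta^-1).+1; rewrite (_ : g _ = B)//.
  apply/seteqP; split=> [t []//|t Bt]; split=> //=.
  have /andP[_ ft1] := f01 t Bt; apply: le_lt_trans ft1 _.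
  by rewrite -ltr_pdivrMr// mul1r truncnS_gt.
have [i gi imin] := ex_minnP gpos.
case: i gi imin => [|i] gi imin.
  have g0 : g 0%N = set0.
    apply/seteqP; split=> [t [Bt /=]|//]; rewrite mul0r => ft0.
    by have /andP[] := f01 t Bt; rewrite leNgt ft0.
  by rewrite g0 measure0 ltxx in gi.
have gi0 : mu (g i) = 0%E.
  apply/eqP; rewrite eq_le measure_ge0 andbT leNgt; apply/negP => /imin.
  by rewrite ltnn.
have dpos : (0 < mu (g i.+1 `\` g i))%E.
  apply: lt_le_trans gi _; rewrite -[leRHS]add0e -gi0.
  have mD : measurable (g i.+1 `\` g i) by exact: measurableD.
  apply: (@le_trans _ _ (mu (g i `|` (g i.+1 `\` g i)))); last exact: measureU2.
  apply: le_measure; rewrite ?inE//; first exact: measurableU.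
  by move=> t gt; have [?|?] := pselect (g i t); [left|right].
have /set0P[t0 [[Bt0 /= t0u] t0l]] : g i.+1 `\` g i != set0.
  by apply/eqP => g0; rewrite g0 measure0 ltxx in dpos.
exists t0 => //; apply: lt_le_trans dpos _; apply: le_measure; rewrite ?inE.
- exact: measurableD.
- by apply: measurableI => //; exact: measurable_fun_dist_le.
- move=> t [[Bt /= tu] tl]; split=> //=.
  have {}tl : i%:R * eta <= f t by rewrite leNgt; apply/negP => ?; exact: tl.
  have {}t0l : i%:R * eta <= f t0 by rewrite leNgt; apply/negP => ?; exact: t0l.
  rewrite -natr1 mulrDl mul1r in tu t0u.
  by rewrite ler_norml; apply/andP; split; lra.
Qed.

(** * From integrals over subsets to an L1 bound *)

Section RealIntegrals.
Context d (T : measurableType d) (R : realType) (mu : {measure set T -> \bar R}).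

Lemma unit_valued_integrable (f : T -> R) (B : set T) :
  measurable B -> (mu B < +oo)%E -> measurable_fun B f ->
  (forall t, `|f t| <= 1) -> mu.-integrable B (EFin \o f).
Proof.
move=> mB Boo mf f1; apply: measurable_bounded_integrable => //.
by exists 1; split=> // M M1 t _ /=; exact: le_trans (f1 t) (ltW M1).
Qed.

(** The sign of [f - p] is constant on each of the two sets [U] and [V] that partition [B]. Testing
    the hypothesis on [U] and on [V] bounds each half of the L1 distance by [e]. *)
Lemma Rintegral_dist_le (f : T -> R) (B : set T) (p e : R) :
  measurable B -> (mu B < +oo)%E -> measurable_fun setT f ->
  mu.-integrable B (EFin \o f) ->
  (forall E, measurable E -> E `<=` B ->
     `|\int[mu]_(t in E) f t - p * fine (mu E)| <= e) ->
  \int[mu]_(t in B) `|f t - p| <= 2 * e.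
Proof.
move=> mB Boo mf fi He.
have mle : measurable [set t | p <= f t].
  by rewrite -preimage_itvcy -[X in measurable X]setTI; exact: mf.
pose U := B `&` [set t | p <= f t]; pose V := B `\` [set t | p <= f t].
have mU : measurable U by exact: measurableI.
have mV : measurable V by exact: measurableD.
have UB : U `<=` B by exact: subIsetl.
have VB : V `<=` B by exact: subDsetl.
have Bfin E : measurable E -> E `<=` B -> (mu E < +oo)%E.
  by move=> mE EB; apply: le_lt_trans Boo; apply: le_measure; rewrite ?inE.
have ci E : measurable E -> E `<=` B -> mu.-integrable E (EFin \o cst p).
  move=> mE EB; apply: measurable_bounded_integrable => //; first exact: Bfin.
  by exists `|p|; split=> // M M1 t _ /=; exact: ltW.
have gi : mu.-integrable B (EFin \o (fun t => f t - p)).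
  rewrite (_ : _ \o _ = (EFin \o f) \- (EFin \o cst p))%E; last exact/funext.
  by apply: integrableB => //; exact: ci.
have int_shift E : measurable E -> E `<=` B ->
    \int[mu]_(t in E) (f t - p) = \int[mu]_(t in E) f t - p * fine (mu E).
  move=> mE EB; rewrite (@RintegralB _ _ _ _ _ f (cst p))//.
  - by rewrite Rintegral_cst.
  - exact: integrableS fi.
  - exact: ci.
have BUV : B = U `|` V by rewrite setUIDK.
have dUV : [disjoint U & V].
  by rewrite disj_set2E; apply/eqP; apply/seteqP; split=> // t [[_ pt] []].
rewrite {1}BUV Rintegral_setU//; last first.
  rewrite -BUV (_ : _ \o _ = abse \o (EFin \o (fun t => f t - p))); last exact/funext.
  exact: integrable_abse.
rewrite (_ : 2 * e = e + e); last by lra.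
apply: lerD.
- rewrite (@eq_Rintegral _ _ _ _ _ (fun t => f t - p)).
    by rewrite int_shift//; apply: le_trans (He U mU UB); exact: ler_norm.
  by move=> t; rewrite inE => -[_ /= pt]; rewrite ger0_norm// subr_ge0.
- rewrite (@eq_Rintegral _ _ _ _ _ (fun t => (-1) * (f t - p))).
    rewrite RintegralZl//; last exact: integrableS gi.
    rewrite int_shift// mulN1r; apply: le_trans (He V mV VB).
    by rewrite -normrN; exact: ler_norm.
  move=> t; rewrite inE => -[_ /= /negP]; rewrite -ltNge => tp.
  by rewrite ltr0_norm ?subr_lt0// mulN1r.
Qed.

End RealIntegrals.

(** * Total variation in terms of real numbers *)

Section TotalVariation.
Context {R : realType}.
Implicit Types P Q : probability (R3 R) R.

Lemma TV_ltP P Q (e : R) G : (TV P Q < e%:E)%E -> measurable G ->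
  `|fine (P G) - fine (Q G)| < e.
Proof.
move=> PQ mG; rewrite -lte_fin; apply: le_lt_trans PQ.
rewrite -abse_EFin EFinB !fineK ?fin_num_measure//.
by apply: ereal_sup_ubound; exists G.
Qed.

Lemma TV_leP P Q (e : R) :
  (forall G, measurable G -> `|fine (P G) - fine (Q G)| <= e) -> (TV P Q <= e%:E)%E.
Proof.
move=> PQ; apply: ge_ereal_sup => _ [G mG <-].
rewrite -[P G]fineK ?fin_num_measure// -[Q G]fineK ?fin_num_measure//.
by rewrite -EFinB abse_EFin lee_fin; exact: PQ.
Qed.

End TotalVariation.

(** * Monotonicity, Lipschitz property and measurability of bivariate copulas *)

Section BivariateCopula.
Context {R : realType} (A : R -> R -> R) (cA : is_copula2 A).

(** The lower bound is the nonnegative volume of the rectangle from [x] to [x'] and from [0] to [y];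
    the upper bound comes from the rectangle above it, from [y] to [1]. *)
Lemma copula2_le_shift_l (x x' y : R) : 0 <= x -> x <= x' -> x' <= 1 -> 0 <= y <= 1 ->
  0 <= A x' y - A x y <= x' - x.
Proof.
move=> x0 xx' x'1 /andP[y0 y1]; have [bd inc] := cA.
have x1 := le_trans xx' x'1; have x'0 := le_trans x0 xx'.
have [|Ax0 _ Ax1 _] := bd x; first by rewrite x0.
have [|Ax'0 _ Ax'1 _] := bd x'; first by rewrite x'0.
have := inc x x' 0 y x0 xx' x'1 (lexx _) y0 y1.
have := inc x x' y 1 x0 xx' x'1 y0 y1 (lexx _).
by lra.
Qed.

Lemma copula2_le_shift_r (x y y' : R) : 0 <= y -> y <= y' -> y' <= 1 -> 0 <= x <= 1 ->
  0 <= A x y' - A x y <= y' - y.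
Proof.
move=> y0 yy' y'1 /andP[x0 x1]; have [bd inc] := cA.
have y1 := le_trans yy' y'1; have y'0 := le_trans y0 yy'.
have [|_ A0y _ A1y] := bd y; first by rewrite y0.
have [|_ A0y' _ A1y'] := bd y'; first by rewrite y'0.
have := inc 0 x y y' (lexx _) x0 x1 y0 yy' y'1.
have := inc x 1 y y' x0 x1 (lexx _) y0 yy' y'1.
by lra.
Qed.

Lemma copula2_lipschitz (x x' y y' : R) :
  0 <= x <= 1 -> 0 <= x' <= 1 -> 0 <= y <= 1 -> 0 <= y' <= 1 ->
  `|A x y - A x' y'| <= `|x - x'| + `|y - y'|.
Proof.
move=> x01 x'01 y01 y'01.
have [/andP[x0 x1] /andP[x'0 x'1]] := (x01, x'01).
have [/andP[y0 y1] /andP[y'0 y'1]] := (y01, y'01).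
have -> : A x y - A x' y' = (A x y - A x' y) + (A x' y - A x' y') by ring.
apply: le_trans (ler_normD _ _) _; apply: lerD.
- have [xx'|/ltW xx'] := leP x x'.
  + have /andP[h0 h1] := copula2_le_shift_l x0 xx' x'1 y01.
    by rewrite distrC (distrC x) !ger0_norm// subr_ge0.
  + have /andP[h0 h1] := copula2_le_shift_l x'0 xx' x1 y01.
    by rewrite !ger0_norm// subr_ge0.
- have [yy'|/ltW yy'] := leP y y'.
  + have /andP[h0 h1] := copula2_le_shift_r y0 yy' y'1 x'01.
    by rewrite distrC (distrC y) !ger0_norm// subr_ge0.
  + have /andP[h0 h1] := copula2_le_shift_r y'0 yy' y1 x'01.
    by rewrite !ger0_norm// subr_ge0.
Qed.

Lemma copula2_unit (x y : R) : 0 <= x <= 1 -> 0 <= y <= 1 -> 0 <= A x y <= 1.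
Proof.
move=> /andP[x0 x1] y01; have [bd _] := cA.
have [|_ A0y _ A1y] := bd y; first by [].
have := @copula2_le_shift_l 0 x y (lexx _) x0 x1 y01.
have := @copula2_le_shift_l x 1 y x0 x1 (lexx _) y01.
by move/andP: y01 => [? ?]; lra.
Qed.

(** Since [A] is monotone in each argument and continuous on the unit square, [c < A (f t) (g t)]
    holds exactly when some rational pair below [(f t, g t)] already has [A]-value above [c]. The
    superlevel set is thus a countable union of measurable sets. *)
Lemma measurable_copula2 d (T : measurableType d) (f g : T -> R) :
  measurable_fun setT f -> measurable_fun setT g ->
  (forall t, 0 <= f t <= 1) -> (forall t, 0 <= g t <= 1) ->
  measurable_fun setT (fun t => A (f t) (g t)).
Proof.
move=> mf mg f01 g01.
have mge (h : T -> R) c : measurable_fun setT h -> measurable [set t | c <= h t].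
  by move=> mh; rewrite -preimage_itvcy -[X in measurable X]setTI; exact: mh.
(* The approximating rational must not leave the unit interval, where alone [A] is controlled; for
   [x = 0] it is therefore [0] itself. *)
have approx (x e : R) : 0 <= x <= 1 -> 0 < e ->
    exists q : rat, 0 <= (ratr q : R) <= x /\ x - ratr q < e.
  move=> /andP[x_ge0 _] e0; have [x_le0|x0] := leP x 0.
    exists 0; rewrite (_ : ratr 0 = 0 :> R) ?rmorph0//.
    by rewrite lexx x_ge0 subr0 (le_lt_trans x_le0).
  have [|q] := @rat_in_itvoo R (Num.max 0 (x - e)) x.
    by rewrite gt_max x0 ltrBlDr ltrDl.
  rewrite in_itv/= gt_max => /andP[/andP[q0 qe] qx].
  by exists q; rewrite !ltW//; split=> //; lra.
apply: (measurability _ (RGenOInfty.measurableE R)) => // _ [_ [c ->] <-].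
rewrite setTI.
pose ok (p : rat * rat) :=
  [/\ 0 <= (ratr p.1 : R) <= 1, 0 <= (ratr p.2 : R) <= 1 & c < A (ratr p.1) (ratr p.2)].
pose F (p : rat * rat) : set T :=
  if `[< ok p >] then [set t | ratr p.1 <= f t] `&` [set t | ratr p.2 <= g t] else set0.
rewrite (_ : _ @^-1` _ = \bigcup_p F p).
  apply: countable_bigcupT_measurable; first exact: countableP.
  by move=> p; rewrite /F; case: ifP => // _; apply: measurableI; exact: mge.
apply/seteqP; split=> t /=.
  rewrite in_itv/= andbT => cA'.
  (* Moving each argument down by less than [e] lowers [A] by less than [2 * e], the whole excess
     over [c]. *)
  pose e := (A (f t) (g t) - c) / 2.
  have e0 : 0 < e by rewrite /e; lra.
  have [a [/andP[a0 af] ae]] := approx (f t) e (f01 t) e0.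
  have [b [/andP[b0 bg] be]] := approx (g t) e (g01 t) e0.
  have /andP[ft0 ft1] := f01 t; have /andP[gt0 gt1] := g01 t.
  have a01 : 0 <= (ratr a : R) <= 1 by rewrite a0 (le_trans af).
  have b01 : 0 <= (ratr b : R) <= 1 by rewrite b0 (le_trans bg).
  exists (a, b) => //; rewrite /F; case: asboolP => [_ //|]; case; split=> //=.
  have /ler_normlP[_] := copula2_lipschitz (f01 t) a01 (g01 t) b01.
  rewrite !ger0_norm ?subr_ge0// => h.
  by move: h ae be; rewrite /e; lra.
move=> [[a b] _]; rewrite /F; case: asboolP => // -[/= a01 b01 cA'] [/= af bg].
rewrite in_itv/= andbT; apply: lt_le_trans cA' _.
have /andP[ft0 ft1] := f01 t; have /andP[gt0 gt1] := g01 t.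
have [/andP[a0 a1] /andP[b0 b1]] := (a01, b01).
have /andP[h1 _] := copula2_le_shift_l a0 af ft1 b01.
have /andP[h2 _] := copula2_le_shift_r b0 bg gt1 (f01 t).
by lra.
Qed.

End BivariateCopula.

(** * Measures given by a density *)

Section DensityMeasure.
Context d (T : measurableType d) (R : realType) (mu : {measure set T -> \bar R}).
Variables (f : T -> \bar R) (f0 : forall t, (0 <= f t)%E) (mf : measurable_fun setT f).

(** The proofs of nonnegativity and measurability are arguments so that the measure structure
    declared below can be inferred from the term. *)
Definition density_measure of (forall t, 0 <= f t)%E & measurable_fun setT f :=
  fun A : set T => (\int[mu]_(x in A) f x)%E.

Local Notation density := (density_measure f0 mf).

Let density0 : density set0 = 0%E.
Proof. exact: integral_set0. Qed.

Let density_ge0 A : (0 <= density A)%E.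
Proof. by apply: integral_ge0 => x _; exact: f0. Qed.

Let density_sigma_additive : semi_sigma_additive density.
Proof.
move=> F mF tF mUF; rewrite /density_measure ge0_integral_bigcup//.
- apply: is_cvg_ereal_nneg_natsum_cond => n _ _.
  by apply: integral_ge0 => x _; exact: f0.
- exact: measurable_funTS.
Qed.

HB.instance Definition _ := isMeasure.Build _ _ _ density
  density0 density_ge0 density_sigma_additive.

End DensityMeasure.

(** * Integrals determined by their values on initial intervals *)

Section IntervalMeasures.
Context {R : realType}.

Lemma lebesgue_measure_prefix (x : R) : 0 <= x ->
  lebesgue_measure (`[0%R, x]%classic : set (RB R)) = x%:E.
Proof.
move=> x0; rewrite lebesgue_measure_itv/= lte_fin; case: ltgtP x0 => //= [_ _|<- _//].
by rewrite oppr0 adde0.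
Qed.

Lemma lebesgue_measure_II : lebesgue_measure (@II R) = 1%E.
Proof. exact: lebesgue_measure_prefix. Qed.

(** Closed rays are stable under intersection, as the uniqueness theorem for measures requires. They
    generate the Borel sets because []a, b]] is a difference of two rays. *)
Lemma measurable_closed_raysE :
  (@measurable _ (measurableTypeR R)) =
  <<s [set A | exists v : R, A = `]-oo, v]%classic] >>.
Proof.
apply/seteqP; split.
  apply: smallest_sub; first exact: smallest_sigma_algebra.
  move=> _ [[a b] _ <-] /=.
  rewrite (_ : `]a, b]%classic = `]-oo, b] `\` `]-oo, a]); last first.
    by rewrite -[RHS]setCK setCD setCitvl setUC -[LHS]setCK setCitv.
  apply: (@measurableD _ (g_sigma_algebraType [set A : set R | exists v : R, A = `]-oo, v]%classic]));
    apply: sub_sigma_algebra; by eexists.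
apply: smallest_sub; first exact: sigma_algebra_measurable.
by move=> _ [v ->]; exact: measurable_itv.
Qed.

(** The two sides, as functions of [E], are finite measures with densities [g] and [h] on [II]. They
    agree on all closed rays, hence on all Borel sets. *)
Lemma integral_eq_of_prefixes (g h : RB R -> R) :
  measurable_fun setT g -> measurable_fun setT h ->
  (forall t, 0 <= g t <= 1) -> (forall t, 0 <= h t <= 1) ->
  (forall v : R, 0 <= v <= 1 ->
    (\int[lebesgue_measure]_(t in `[0%R, v]%classic) (g t)%:E =
     \int[lebesgue_measure]_(t in `[0%R, v]%classic) (h t)%:E)%E) ->
  forall E : set (RB R), measurable E ->
    (\int[lebesgue_measure]_(t in E `&` II) (g t)%:E =
     \int[lebesgue_measure]_(t in E `&` II) (h t)%:E)%E.
Proof.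
move=> mg mh g01 h01 gh E mE.
have mII : measurable (@II R) by exact: measurable_itv.
pose patch (k : RB R -> R) : RB R -> \bar R := (EFin \o k) \_ (@II R).
have p0 (k : RB R -> R) : (forall t, 0 <= k t <= 1) -> forall t, (0 <= patch k t)%E.
  move=> k01 t; rewrite /patch patchE; case: ifP => // _.
  by rewrite lee_fin; case/andP: (k01 t).
have mp (k : RB R -> R) : measurable_fun setT k -> measurable_fun setT (patch k).
  move=> mk; apply: (measurable_restrictT (EFin \o k) mII).1; apply: measurable_funTS.
  exact/measurable_EFinP.
pose m k k01 mk : {measure set (RB R) -> \bar R} :=
  density_measure (@lebesgue_measure R) (p0 k k01) (mp k mk).
have mE' k k01 mk A : m k k01 mk A =
    (\int[lebesgue_measure]_(t in A `&` II) (k t)%:E)%E.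
  by rewrite integral_mkcondr.
(* Inside [II] a ray is either empty or an initial interval, so the hypothesis covers every ray. *)
have rayII (v : R) : `]-oo, v]%classic `&` @II R =
    if v < 0 then set0 else `[0%R, Num.min v 1]%classic.
  case: ltP => v0; apply/seteqP; split=> t //=; rewrite /II /= ?in_itv/= ?le_min.
  - by move=> [tv /andP[/le_trans/(_ tv)]]; rewrite leNgt v0.
  - by move=> [-> /andP[-> ->]].
  - by move=> /andP[-> /andP[-> ->]].
suff : m g g01 mg E = m h h01 mh E by rewrite !mE'.
pose rays : set (set (RB R)) := [set A | exists v : R, A = `]-oo, v]%classic].
apply: (@measure_unique _ R (RB R) rays (fun n => `]-oo, n%:R]%classic)) => //.
- exact: measurable_closed_raysE.
- move=> _ _ [v ->] [w ->]; exists (Num.min v w).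
  by apply/seteqP; split=> t /=; rewrite !in_itv/= le_min => /andP.
- by move=> n; exists n%:R.
- apply/seteqP; split=> // t _; exists (Num.truncn `|t|).+1 => //=.
  by rewrite in_itv/=; apply: le_trans (ler_norm t) _; exact/ltW/truncnS_gt.
- move=> _ [v ->]; rewrite !mE' rayII; case: ltP => v0; first by rewrite !integral_set0.
  by apply: gh; rewrite le_min v0 ler01 ge_min lexx orbT.
- move=> n; rewrite mE'.
  apply: (@le_lt_trans _ _ (\int[lebesgue_measure]_(t in II) 1)%E).
    apply: (@le_trans _ _ (\int[lebesgue_measure]_(t in II) (g t)%:E)%E).
      apply: ge0_subset_integral => //.
      + by apply: measurableI => //; exact: measurable_itv.
      + by apply/measurable_EFinP; exact: measurable_funTS.
      + by move=> t _; rewrite lee_fin; case/andP: (g01 t).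
    apply: ge0_le_integral => //.
    + by move=> t _; rewrite lee_fin; case/andP: (g01 t).
    + by apply/measurable_EFinP; exact: measurable_funTS.
    + by move=> t _; rewrite lee_fin; case/andP: (g01 t).
  by rewrite (integral_cst _ mII 1%E) mul1e [ltLHS]lebesgue_measure_II ltry.
Qed.

End IntervalMeasures.

(** * Slices of a copula and its conditional distributions *)

Section Disintegration.
Context {R : realType}.
Implicit Types (P : probability (R3 R) R) (K : RB R -> probability (R2 R) R).
Local Notation leb := (@lebesgue_measure R).

Lemma measurable_II : measurable (@II R).
Proof. exact: measurable_itv. Qed.

Lemma lebesgue_unit_lty (E : set (RB R)) : measurable E -> E `<=` II ->
  (leb E < +oo)%E.
Proof.
move=> mE EI; apply: (@le_lt_trans _ _ (leb II)).
  by apply: le_measure; rewrite ?inE//; exact: measurable_II.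
by rewrite lebesgue_measure_II ltry.
Qed.

Lemma fine_prob01 d (T : measurableType d) (P : probability T R) (G : set T) :
  measurable G -> 0 <= fine (P G) <= 1.
Proof.
move=> mG; rewrite fine_ge0//= -lee_fin fineK ?fin_num_measure//.
exact: probability_le1.
Qed.

Lemma measurable_rcd P K (Q : set (R2 R)) : is_rcd P K -> measurable Q ->
  measurable_fun setT (fun t : RB R => fine (K t Q)).
Proof.
move=> [mK _] mQ.
exact: (measurableT_comp (fine_measurable measurableT) (mK Q mQ)).
Qed.

Lemma rcd_slice P K (Q : set (R2 R)) (E : set (RB R)) : is_rcd P K ->
  measurable Q -> measurable E -> E `<=` II ->
  fine (P (Q `*` E)) = \int[leb]_(t in E) fine (K t Q).
Proof.
move=> [_ PK] mQ mE EI; rewrite PK// setIidl//; congr fine.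
by apply: eq_integral => t _; rewrite /= fineK ?fin_num_measure.
Qed.

(** The definition of a simplified copula only speaks of conditioning values in [[0, v]]. Comparing
    [K t] of the box with [A] of the conditional margins, both as densities in [t], extends it to
    every measurable [E]. *)
Lemma simplified_slice P K (A : R -> R -> R) (u1 u2 : R) (E : set (RB R)) :
  is_rcd P K -> is_copula2 A ->
  (forall u1 u2 v : R, 0 <= u1 <= 1 -> 0 <= u2 <= 1 -> 0 <= v <= 1 ->
       (cdf3 P u1 u2 v)%:E =
       (\int[leb]_(t in `[0%R, v]%classic) (A (F13 K u1 t) (F23 K u2 t))%:E)%E) ->
  0 <= u1 <= 1 -> 0 <= u2 <= 1 -> measurable E -> E `<=` II ->
  fine (P ((`[0%R, u1]%classic `*` `[0%R, u2]%classic) `*` E)) =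
  \int[leb]_(t in E) A (F13 K u1 t) (F23 K u2 t).
Proof.
move=> PK cA PA u1I u2I mE EI.
have mQ : measurable (`[0%R, u1]%classic `*` `[0%R, u2]%classic : set (R2 R)).
  by apply: measurableX; exact: measurable_itv.
have mQ1 : measurable (`[0%R, u1]%classic `*` II : set (R2 R)).
  by apply: measurableX; exact: measurable_itv.
have mQ2 : measurable (II `*` `[0%R, u2]%classic : set (R2 R)).
  by apply: measurableX; exact: measurable_itv.
rewrite (rcd_slice PK)// /Rintegral -[E in LHS](setIidl EI) -[E in RHS](setIidl EI).
congr fine; apply: integral_eq_of_prefixes => //.
- exact: measurable_rcd PK _.
- apply: (measurable_copula2 cA); try exact: measurable_rcd PK _.
  + by move=> t; exact: fine_prob01.
  + by move=> t; exact: fine_prob01.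
- by move=> t; exact: fine_prob01.
- by move=> t; apply: (copula2_unit cA); exact: fine_prob01.
- move=> v v01; have /andP[v0 v1] := v01; rewrite -PA// /cdf3.
  have [_ PK2] := PK.
  have vI : `[0%R, v]%classic `<=` @II R.
    by move=> t /=; rewrite /II /= !in_itv/= => /andP[-> /le_trans ->].
  rewrite fineK ?fin_num_measure//; last by apply: measurableX => //; exact: measurable_itv.
  rewrite PK2// setIidl//.
  by apply: eq_integral => t _; rewrite /= fineK ?fin_num_measure.
Qed.

(* The conditional margins of [P] are nearly constant over [B], so by the
   Lipschitz property the mass of the box is governed by one value of [A]. *)
Lemma simplified_box_mass P (u1 u2 : R) : simplified P ->
  0 <= u1 <= 1 -> 0 <= u2 <= 1 ->
  exists A : R -> R -> R,
    forall (B : set (RB R)) (p1 p2 e : R), measurable B -> B `<=` II ->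
    0 <= p1 <= 1 -> 0 <= p2 <= 1 ->
    (forall E, measurable E -> E `<=` B ->
      `|fine (P ((`[0%R, u1]%classic `*` II) `*` E)) - p1 * fine (leb E)| <= e) ->
    (forall E, measurable E -> E `<=` B ->
      `|fine (P ((II `*` `[0%R, u2]%classic) `*` E)) - p2 * fine (leb E)| <= e) ->
    `|fine (P ((`[0%R, u1]%classic `*` `[0%R, u2]%classic) `*` B)) -
      A p1 p2 * fine (leb B)| <= 4 * e.
Proof.
move=> [K [PK [A [cA [PA _]]]]] u1I u2I; exists A.
move=> B p1 p2 e mB BI p1I p2I H1 H2.
rewrite (simplified_slice PK cA PA)//.
have mQ1 : measurable (`[0%R, u1]%classic `*` II : set (R2 R)).
  by apply: measurableX; exact: measurable_itv.
have mQ2 : measurable (II `*` `[0%R, u2]%classic : set (R2 R)).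
  by apply: measurableX; exact: measurable_itv.
have mF1 : measurable_fun setT (F13 K u1) by exact: measurable_rcd PK _.
have mF2 : measurable_fun setT (F23 K u2) by exact: measurable_rcd PK _.
have F1I t : 0 <= F13 K u1 t <= 1 by exact: fine_prob01.
have F2I t : 0 <= F23 K u2 t <= 1 by exact: fine_prob01.
have Boo : (leb B < +oo)%E by exact: lebesgue_unit_lty.
have unit_int (f : RB R -> R) : measurable_fun setT f ->
    (forall t, 0 <= f t <= 1) -> leb.-integrable B (EFin \o f).
  move=> mf fI; apply: unit_valued_integrable => //; first exact: measurable_funTS.
  by move=> t; have /andP[f0 f1] := fI t; rewrite ger0_norm.
have dist_int (f : RB R -> R) (p : R) : measurable_fun setT f ->
    (forall t, 0 <= f t <= 1) -> 0 <= p <= 1 ->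
    leb.-integrable B (EFin \o (fun t => `|f t - p|)).
  move=> mf fI /andP[p0 p1']; apply: unit_valued_integrable => //.
    apply: measurable_funTS; apply: measurableT_comp => //.
    exact: measurable_funB.
  move=> t; have /andP[f0 f1] := fI t.
  by rewrite normr_id ler_norml; apply/andP; split; lra.
(* The mass of a slab over [E] is the integral over [E] of the conditional margin, so [H1] becomes
   an L1 bound. This bound and its analogue [L2] add up to [4 * e]. *)
have L1 : \int[leb]_(t in B) `|F13 K u1 t - p1| <= 2 * e.
  apply: Rintegral_dist_le => //; first exact: unit_int.
  move=> E mE EB; rewrite -(rcd_slice PK)//; first exact: H1.
  exact: subset_trans BI.
have L2 : \int[leb]_(t in B) `|F23 K u2 t - p2| <= 2 * e.
  apply: Rintegral_dist_le => //; first exact: unit_int.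
  move=> E mE EB; rewrite -(rcd_slice PK)//; first exact: H2.
  exact: subset_trans BI.
pose h t := A (F13 K u1 t) (F23 K u2 t).
have mh : measurable_fun setT h by exact: (measurable_copula2 cA).
have hI t : 0 <= h t <= 1 by exact: (copula2_unit cA).
have AI : 0 <= A p1 p2 <= 1 by exact: (copula2_unit cA).
have -> : \int[leb]_(t in B) A (F13 K u1 t) (F23 K u2 t) - A p1 p2 * fine (leb B)
    = \int[leb]_(t in B) (h t - A p1 p2).
  rewrite (@RintegralB _ _ _ _ _ h (cst (A p1 p2)))//.
  - by rewrite Rintegral_cst.
  - exact: unit_int.
  - exact: unit_int.
have hAi : leb.-integrable B (EFin \o (fun t => h t - A p1 p2)).
  apply: unit_valued_integrable => //.
    by apply: measurable_funTS; exact: measurable_funB.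
  move=> t; have [/andP[? ?] /andP[? ?]] := (hI t, AI).
  by rewrite ler_norml; apply/andP; split; lra.
apply: le_trans (le_normr_Rintegral _ _) _ => //.
apply: (@le_trans _ _ (\int[leb]_(t in B) (`|F13 K u1 t - p1| + `|F23 K u2 t - p2|))).
  apply: le_Rintegral => //.
  - exact: dist_int.
  - exact: (integrableD mB (dist_int _ p1 mF1 F1I p1I) (dist_int _ p2 mF2 F2I p2I)).
  - by move=> t _; exact: (copula2_lipschitz cA).
rewrite RintegralD//; [|exact: dist_int|exact: dist_int].
by lra.
Qed.

End Disintegration.

(** * The block copula and its mixture with a given copula *)

Section BlockPerturbation.
Context {R : realType}.
Local Notation leb := (@lebesgue_measure R).
Local Notation len X := (fine (leb X)).
Local Notation lower := (`[0%R, 2^-1]%classic : set (RB R)).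
Local Notation upper := (`]2^-1, 1%R]%classic : set (RB R)).

Let vol : {measure set (R3 R) -> \bar R} := ((leb \x leb) \x leb)%E.

Lemma len_fineK (X : set (RB R)) : measurable X -> X `<=` II ->
  leb X = (len X)%:E.
Proof.
by move=> mX XI; rewrite fineK// ge0_fin_numE//; exact: lebesgue_unit_lty.
Qed.

Lemma len_set0 : len (set0 : set (RB R)) = 0.
Proof. by rewrite measure0. Qed.

Lemma lenU (X Y : set (RB R)) : measurable X -> measurable Y ->
  X `<=` II -> Y `<=` II -> [disjoint X & Y] -> len (X `|` Y) = len X + len Y.
Proof.
move=> mX mY XI YI XY; rewrite measureU//; last by apply/eqP; rewrite -disj_set2E.
by rewrite fineD// ge0_fin_numE//; exact: lebesgue_unit_lty.
Qed.

Lemma lower_sub : lower `<=` II.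
Proof. by move=> t; rewrite /II /= !in_itv/= => /andP[-> ?]; lra. Qed.

Lemma upper_sub : upper `<=` II.
Proof. by move=> t; rewrite /II /= !in_itv/= => /andP[? ->]; lra. Qed.

Lemma len_lower : len lower = 2^-1.
Proof. by rewrite lebesgue_measure_prefix. Qed.

Lemma len_upper : len upper = 2^-1.
Proof.
rewrite lebesgue_measure_itv/= lte_fin ifT; last by lra.
by rewrite -EFinB /=; lra.
Qed.

Lemma len_II : len (@II R) = 1.
Proof. by rewrite lebesgue_measure_II. Qed.

Lemma len_halves (X : set (RB R)) : measurable X ->
  len (X `&` lower) + len (X `&` upper) = len (X `&` II).
Proof.
move=> mX; rewrite -lenU.
- congr (len _); rewrite -setIUr; congr (_ `&` _).
  apply/seteqP; split=> [t [/lower_sub//|/upper_sub//]|t].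
  rewrite /II /= !in_itv/= => /andP[t0 t1].
  by have [t2|t2] := leP t 2^-1; [left; rewrite t0|right; rewrite t1].
- by apply: measurableI => //; exact: measurable_itv.
- by apply: measurableI => //; exact: measurable_itv.
- by move=> t [_ /lower_sub].
- by move=> t [_ /upper_sub].
- rewrite disj_set2E; apply/eqP/seteqP; split=> // t [[_ /=]].
  rewrite in_itv/= => /andP[_ t1] [_ /=]; rewrite in_itv/= => /andP[+ _].
  by rewrite ltNge t1.
Qed.

Lemma vol_box (X Y Z : set (RB R)) : measurable X -> measurable Y -> measurable Z ->
  X `<=` II -> Y `<=` II -> Z `<=` II ->
  vol ((X `*` Y) `*` Z) = (len X * len Y * len Z)%:E.
Proof.
move=> mX mY mZ XI YI ZI.
have mXY : measurable (X `*` Y : set (R2 R)) by exact: measurableX.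
have -> : vol ((X `*` Y) `*` Z) = ((leb \x leb) (X `*` Y) * leb Z)%E.
  exact: product_measure1E.
have -> : (leb \x leb)%E (X `*` Y) = (leb X * leb Y)%E by exact: product_measure1E.
by rewrite (len_fineK mX)// (len_fineK mY)// (len_fineK mZ)// -!EFinM.
Qed.

Context (B : set (RB R)) (mB : measurable B) (BI : B `<=` II).

Let W0 : set (R3 R) := (II `*` II) `*` (II `\` B).
Let W1 : set (R3 R) := (lower `*` lower) `*` B.
Let W2 : set (R3 R) := (upper `*` upper) `*` B.

Let mW0 : measurable W0.
Proof.
apply: measurableX; last by apply: measurableD => //; exact: measurable_II.
by apply: measurableX; exact: measurable_II.
Qed.

Let mW1 : measurable W1.
Proof. by apply: measurableX => //; apply: measurableX; exact: measurable_itv. Qed.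

Let mW2 : measurable W2.
Proof. by apply: measurableX => //; apply: measurableX; exact: measurable_itv. Qed.

(* Over [B] the first two coordinates lie in the same half, elsewhere they are
   independent; all one-dimensional margins are uniform. *)
Definition block_density (x : R3 R) : R := \1_W0 x + (2 * \1_W1 x + 2 * \1_W2 x).

Lemma block_density_ge0 x : 0 <= block_density x.
Proof. by rewrite /block_density !addr_ge0// mulr_ge0// indicE. Qed.

Lemma measurable_block_density : measurable_fun setT block_density.
Proof.
apply: measurable_funD; first exact: measurable_indic.
by apply: measurable_funD; apply: measurable_funM => //; exact: measurable_indic.
Qed.

Let w0 x : (0 <= (block_density x)%:E)%E.
Proof. by rewrite lee_fin block_density_ge0. Qed.

Let mw : measurable_fun setT (EFin \o block_density).
Proof. by apply/measurable_EFinP; exact: measurable_block_density. Qed.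

Definition block_measure : {measure set (R3 R) -> \bar R} :=
  density_measure vol w0 mw.

Lemma block_measureE G : measurable G ->
  block_measure G = (vol (W0 `&` G) + (2%:E * vol (W1 `&` G) + 2%:E * vol (W2 `&` G)))%E.
Proof.
move=> mG; rewrite /block_measure /= /density_measure.
have mi (W : set (R3 R)) : measurable W ->
    measurable_fun G (fun x => (\1_W x : R)%:E).
  by move=> mW; apply/measurable_EFinP; exact: measurable_indic.
have mi2 (W : set (R3 R)) : measurable W ->
    measurable_fun G (fun x => (2%:E * (\1_W x : R)%:E)%E).
  by move=> mW; apply: measurable_funeM; exact: mi.
have int2 (W : set (R3 R)) : measurable W ->
    (\int[vol]_(x in G) (2%:E * (\1_W x : R)%:E) = 2%:E * vol (W `&` G))%E.
  by move=> mW; rewrite ge0_integralZl_EFin//; [rewrite integral_indic|exact: mi].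
have pos (W : set (R3 R)) x : (0 <= 2%:E * (\1_W x : R)%:E)%E.
  by rewrite mule_ge0// lee_fin indicE.
under eq_integral do rewrite /= /block_density EFinD EFinD !EFinM.
rewrite ge0_integralD//.
- rewrite ge0_integralD//; [|exact: mi2|exact: mi2].
  by rewrite integral_indic// !int2.
- exact: mi.
- by move=> x _; rewrite adde_ge0.
- by apply: emeasurable_funD; exact: mi2.
Qed.

(** Each of the three blocks is itself a box, so its intersection with a box has a volume that
    factors into lengths. The masses computed below are instances of this formula. *)
Lemma block_measure_box (X Y Z : set (RB R)) :
  measurable X -> measurable Y -> measurable Z ->
  block_measure ((X `*` Y) `*` Z) =
  (len (X `&` II) * len (Y `&` II) * len (Z `&` (II `\` B)) +
   (2 * (len (X `&` lower) * len (Y `&` lower) * len (Z `&` B)) +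
    2 * (len (X `&` upper) * len (Y `&` upper) * len (Z `&` B))))%:E.
Proof.
move=> mX mY mZ; rewrite block_measureE; last first.
  by apply: measurableX => //; exact: measurableX.
have mII := @measurable_II R.
have ml : measurable lower by exact: measurable_itv.
have mu' : measurable upper by exact: measurable_itv.
rewrite !EFinD !EFinM.
have box (U V : set (RB R)) : measurable U -> measurable V -> U `<=` II -> V `<=` II ->
   vol (((U `*` U) `*` V) `&` ((X `*` Y) `*` Z)) =
   (len (X `&` U) * len (Y `&` U) * len (Z `&` V))%:E.
  move=> mU mV UI VI; rewrite setIC -setXI -setXI vol_box//.
  - exact: measurableI.
  - exact: measurableI.
  - exact: measurableI.
  - by move=> t [_ /UI].
  - by move=> t [_ /UI].
  - by move=> t [_ /VI].
have mD : measurable (II `\` B) by exact: measurableD.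
have DI : II `\` B `<=` II by exact: subDsetl.
by rewrite !box// ?EFinM//; [exact: upper_sub|exact: lower_sub].
Qed.

Let len_split (Z : set (RB R)) : measurable Z ->
  len (Z `&` (II `\` B)) + len (Z `&` B) = len (Z `&` II).
Proof.
move=> mZ; have mD : measurable (II `\` B) by apply: measurableD => //; exact: measurable_II.
rewrite -lenU.
- congr (len _); rewrite -setIUr; congr (_ `&` _).
  by rewrite setUC setDUK.
- exact: measurableI.
- exact: measurableI.
- by move=> t [_ []].
- by move=> t [_ /BI].
- by rewrite disj_set2E; apply/eqP/seteqP; split=> // t [[_ [_ nB]] [_ /nB]].
Qed.

Let lowerI : II `&` lower = lower. Proof. by rewrite setIidr//; exact: lower_sub. Qed.
Let upperI : II `&` upper = upper. Proof. by rewrite setIidr//; exact: upper_sub. Qed.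
Let lower_upper : lower `&` upper = set0.
Proof.
apply/seteqP; split=> // t [/=]; rewrite !in_itv/= => /andP[_ t1] /andP[+ _].
by rewrite ltNge t1.
Qed.

Let mlower : measurable lower. Proof. exact: measurable_itv. Qed.
Let mII := @measurable_II R.

(** The weight 2 in the density makes this work: over [B] each half of [X] is paired with a half of
    length [1/2], and the factor 2 restores the full length. *)
Lemma block_measure_margin1 (X : set (RB R)) : measurable X ->
  block_measure ((X `*` setT) `*` setT) = (len (X `&` II))%:E.
Proof.
move=> mX; rewrite block_measure_box// !setTI len_II len_lower len_upper.
congr EFin; have := len_split measurableT; have := len_halves mX.
rewrite !setTI len_II => <- h.
have -> : len (II `\` B) = 1 - len B by lra.
by field.
Qed.

Lemma block_measure_margin2 (X : set (RB R)) : measurable X ->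
  block_measure ((setT `*` X) `*` setT) = (len (X `&` II))%:E.
Proof.
move=> mX; rewrite block_measure_box// !setTI len_II len_lower len_upper.
congr EFin; have := len_split measurableT; have := len_halves mX.
rewrite !setTI len_II => <- h.
have -> : len (II `\` B) = 1 - len B by lra.
by field.
Qed.

Lemma block_measure_margin3 (X : set (RB R)) : measurable X ->
  block_measure ((setT `*` setT) `*` X) = (len (X `&` II))%:E.
Proof.
move=> mX; rewrite block_measure_box// !setTI len_II len_lower len_upper.
congr EFin; rewrite -(len_split mX); by field.
Qed.

Lemma block_measureT : block_measure setT = 1%E.
Proof. by rewrite -!setXTT block_measure_margin1// setTI len_II. Qed.

Lemma block_measure_I3 : block_measure I3 = 1%E.
Proof.
rewrite /I3 block_measure_box// !setIid lowerI upperI len_II len_lower len_upper.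
congr EFin; have := len_split mII; rewrite setIid len_II => h.
have -> : len (II `&` (II `\` B)) = 1 - len (II `&` B) by lra.
by field.
Qed.

(** The value does not depend on how [E] meets [B]: the conditional margins at [1/2] cannot detect
    [B]. *)
Lemma block_measure_lower1 (E : set (RB R)) : measurable E -> E `<=` II ->
  block_measure ((lower `*` II) `*` E) = (len E / 2)%:E.
Proof.
move=> mE EI; rewrite block_measure_box// setIid (setIC lower) !lowerI upperI.
rewrite !setIid lower_upper len_II len_set0 len_lower; congr EFin.
by rewrite -[in RHS](setIidl EI) -(len_split mE); field.
Qed.

Lemma block_measure_lower2 (E : set (RB R)) : measurable E -> E `<=` II ->
  block_measure ((II `*` lower) `*` E) = (len E / 2)%:E.
Proof.
move=> mE EI; rewrite block_measure_box// setIid (setIC lower) !lowerI upperI.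
rewrite !setIid lower_upper len_II len_set0 len_lower; congr EFin.
by rewrite -[in RHS](setIidl EI) -(len_split mE); field.
Qed.

(** In contrast to the margins, this mass detects [B]: the lower square has conditional mass [1/2]
    over [B] and [1/4] elsewhere. *)
Lemma block_measure_lower12 (E : set (RB R)) : measurable E -> E `<=` II ->
  block_measure ((lower `*` lower) `*` E) = (len E / 4 + len (E `&` B) / 4)%:E.
Proof.
move=> mE EI; rewrite block_measure_box// (setIC lower II) !lowerI.
rewrite !setIid lower_upper len_set0 len_lower; congr EFin.
have -> : len E = len (E `&` (II `\` B)) + len (E `&` B).
  by rewrite len_split// (setIidl EI).
by field.
Qed.

(** * Mixtures with the block copula *)

Section Mixture.
Context (S : probability (R3 R) R) (th : R) (th0 : 0 <= th) (th1 : th <= 1).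

Lemma block_mixture_exists : exists P : probability (R3 R) R,
  forall G, P G = ((1 - th)%:E * S G + th%:E * block_measure G)%E.
Proof.
have th1' : 0 <= 1 - th by rewrite subr_ge0.
pose m : {measure set (R3 R) -> \bar R} := measure_add (mscale (NngNum th1') S) (mscale (NngNum th0) block_measure).
have mE G : m G = ((1 - th)%:E * S G + th%:E * block_measure G)%E.
  exact: measure_addE.
have mT : m setT = 1%E.
  by rewrite mE block_measureT probability_setT !mule1 -EFinD subrK.
(* As [m] has total mass 1, normalizing leaves its values unchanged and only supplies the
   probability structure; the default [S] is never taken. *)
exists (mnormalize m S) => G; rewrite -mE /= /mnormalize [m setT]mT /=.
by rewrite eqe oner_eq0 /= invr1 mule1.
Qed.

Context (P : probability (R3 R) R).
Hypothesis PE : forall G, P G = ((1 - th)%:E * S G + th%:E * block_measure G)%E.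

Lemma block_mixture_fine G : measurable G ->
  fine (P G) = (1 - th) * fine (S G) + th * fine (block_measure G).
Proof.
move=> mG; have bf : block_measure G \is a fin_num.
  rewrite ge0_fin_numE//; apply: (@le_lt_trans _ _ (block_measure setT)).
    by apply: le_measure; rewrite ?inE.
  by rewrite block_measureT ltry.
by rewrite PE -[S G]fineK ?fin_num_measure// -[in LHS](fineK bf).
Qed.

(** On each event the difference is [th] times a difference of two probabilities. *)
Lemma block_mixture_TV : (TV S P <= th%:E)%E.
Proof.
apply: TV_leP => G mG; rewrite block_mixture_fine//.
have /andP[s0 s1] := fine_prob01 S mG.
have b0 : 0 <= fine (block_measure G) by rewrite fine_ge0.
have b1 : fine (block_measure G) <= 1.
  rewrite -[leRHS]/(fine 1%E) -block_measureT fine_le ?block_measureT//.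
    rewrite ge0_fin_numE//; apply: (@le_lt_trans _ _ (block_measure setT)).
      by apply: le_measure; rewrite ?inE.
    by rewrite block_measureT ltry.
  by rewrite -block_measureT; apply: le_measure; rewrite ?inE.
rewrite (_ : _ - _ = th * (fine (S G) - fine (block_measure G))); last by ring.
rewrite normrM ger0_norm// ler_piMr// ler_norml; apply/andP; split; lra.
Qed.

Lemma block_mixture_copula : is_copula3 S -> is_copula3 P.
Proof.
move=> [SI3 SM].
have conv (x : R) : ((1 - th)%:E * x%:E + th%:E * x%:E)%E = x%:E.
  by rewrite -!EFinM -EFinD -mulrDl subrK mul1r.
split; first by rewrite PE SI3 block_measure_I3 conv.
move=> x x01; have [S1 S2 S3] := SM x x01; have /andP[x0 x1] := x01.
have pre : len (`[0%R, x]%classic `&` II) = x.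
  rewrite setIidl ?lebesgue_measure_prefix// => t /=.
  by rewrite /II /= !in_itv/= => /andP[-> /le_trans ->].
have mx : measurable (`[0%R, x]%classic : set (RB R)) by exact: measurable_itv.
split; rewrite PE.
- by rewrite S1 block_measure_margin1// pre conv.
- by rewrite S2 block_measure_margin2// pre conv.
- by rewrite S3 block_measure_margin3// pre conv.
Qed.

Lemma block_mixture_ac_pos : th < 1 -> is_copula3 S -> ac_pos S -> ac_pos P.
Proof.
move=> th1' [SI3 _] [f [mf [f0 Sf]]].
have mI3 : measurable (@I3 R) by apply: measurableX => //; exact: measurableX.
(* The sign of [f] is known on [I3] only. Cutting it off outside makes it nonnegative everywhere,
   for additivity of the integral, and keeps it a density of [S], which is concentrated on [I3]. *)
pose g := f \_ (@I3 R).
have g0 x : 0 <= g x.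
  by rewrite /g patchE; case: ifPn => //; rewrite inE => /f0/ltW.
have mg : measurable_fun setT g.
  by apply: (measurable_restrictT f mI3).1; exact: measurable_funTS.
exists (fun x => (1 - th) * g x + th * block_density x); split; last split.
- by apply: measurable_funD; apply: measurable_funM => //; exact: measurable_block_density.
- move=> x xI; rewrite ltr_pwDl//.
    by rewrite mulr_gt0 ?subr_gt0// /g patchE mem_set//; exact: f0.
  by rewrite mulr_ge0// block_density_ge0.
- move=> G mG; rewrite PE.
  have -> : S G = (\int[vol]_(x in G) (g x)%:E)%E.
    transitivity (S (G `&` I3)).
      have SC : S (~` I3) = 0%E by rewrite probability_setC// SI3 subee.
      have S0 : S (G `\` I3) = 0%E.
        apply: (@subset_measure0 _ _ _ S _ (~` I3)) => //; first exact: measurableD.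
        exact: measurableC.
      have -> : S G = (S (G `\` I3) + S (G `&` I3))%E by exact: measureDI.
      by rewrite S0 add0e.
    rewrite Sf; last exact: measurableI.
    rewrite integral_mkcondr; apply: eq_integral => x _.
    by rewrite /g !patchE; case: ifP.
  rewrite /block_measure /= /density_measure.
  rewrite -ge0_integralZl_EFin ?subr_ge0//; last 2 first.
    by move=> x _; rewrite lee_fin.
    by apply/measurable_EFinP; exact: measurable_funTS.
  rewrite -ge0_integralZl_EFin//; last exact: measurable_funTS.
  rewrite -ge0_integralD//.
  + by move=> x _; rewrite mule_ge0// lee_fin// subr_ge0.
  + by apply: measurable_funeM; apply/measurable_EFinP; exact: measurable_funTS.
  + by move=> x _; rewrite mule_ge0.
  + by apply: measurable_funeM; exact: measurable_funTS.
Qed.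

End Mixture.
End BlockPerturbation.

(** * Separation from the simplified copulas and nowhere density *)

Section SimplifiedNowhereDense.
Context {R : realType}.
Local Notation leb := (@lebesgue_measure R).
Local Notation len X := (fine (leb X)).
Local Notation lower := (`[0%R, 2^-1]%classic : set (RB R)).

Lemma Rintegral_near_cst (f : RB R -> R) (E : set (RB R)) (p eta : R) :
  measurable E -> E `<=` II -> measurable_fun setT f -> (forall t, 0 <= f t <= 1) ->
  (forall t, E t -> `|f t - p| <= eta) ->
  `|\int[leb]_(t in E) f t - p * len E| <= eta * len E.
Proof.
move=> mE EI mf f01 fp; have Eoo := lebesgue_unit_lty mE EI.
have fi : leb.-integrable E (EFin \o f).
  apply: unit_valued_integrable => //; first exact: measurable_funTS.
  by move=> t; have /andP[f0 f1] := f01 t; rewrite ger0_norm.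
have ci (c : R) : leb.-integrable E (EFin \o cst c).
  apply: measurable_bounded_integrable => //.
  by exists `|c|; split=> // M M1 t _ /=; exact: ltW.
have lo : \int[leb]_(t in E) (p - eta) <= \int[leb]_(t in E) f t.
  apply: le_Rintegral => //; first exact: ci.
  by move=> t Et; have := fp t Et; rewrite ler_norml => /andP[]; lra.
have hi : \int[leb]_(t in E) f t <= \int[leb]_(t in E) (p + eta).
  apply: le_Rintegral => //; first exact: ci.
  by move=> t Et; have := fp t Et; rewrite ler_norml => /andP[]; lra.
move: lo hi; rewrite !Rintegral_cst//.
move: (\int[leb]_(t in E) f t) (len E) => I l lo hi.
by rewrite ler_norml; apply/andP; split; lra.
Qed.

(** Pigeonhole for the identity function yields a part [B1] of positive measure inside an interval
    of length [len B / 2], which leaves at least half of [B] for the complement. *)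
Lemma split_positive (B : set (RB R)) : measurable B -> B `<=` II ->
  (0 < leb B)%E ->
  exists B1 B2 : set (RB R), [/\ measurable B1, measurable B2, B1 `<=` B, B2 `<=` B &
    [/\ B1 `&` B2 = set0, 0 < len B1 & 0 < len B2]].
Proof.
move=> mB BI B0; have mid : measurable_fun setT (idfun : RB R -> R) by exact: measurable_id.
have lB0 : 0 < len B by rewrite -lte_fin -len_fineK.
have e0 : 0 < len B / 4 by lra.
have id01 (t : RB R) : B t -> 0 <= t <= 1.
  by move=> /BI; rewrite /II /= in_itv.
have [t0 Bt0 pos] := positive_level_set mid id01 mB e0 B0.
set B1 := B `&` _ in pos.
have mB1 : measurable B1.
  by apply: measurableI => //; exact: (measurable_fun_dist_le _ _ mid).
have B1B : B1 `<=` B by exact: subIsetl.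
have B1I : B1 `<=` II := subset_trans B1B BI.
have mB2 : measurable (B `\` B1) by exact: measurableD.
have B2I : B `\` B1 `<=` II by exact: subset_trans BI.
exists B1, (B `\` B1); split=> //; split.
- by rewrite setDE setICA setICr setI0.
- by rewrite -lte_fin -len_fineK.
- have BE : len B = len B1 + len (B `\` B1).
    rewrite -lenU// ?setDUK//.
    by rewrite disj_set2E setDE setICA setICr setI0.
  have : len B1 <= len B / 2.
    have sub : B1 `<=` `[t0 - len B / 4, t0 + len B / 4]%classic.
      move=> t [_ /=]; rewrite ler_norml in_itv/= => /andP[? ?].
      by apply/andP; split; lra.
    rewrite -lee_fin -len_fineK//.
    apply: (@le_trans _ _ (leb `[t0 - len B / 4, t0 + len B / 4]%classic)).
      by apply: le_measure; rewrite ?inE.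
    rewrite lebesgue_measure_itv/= lte_fin ifT; last by lra.
    by rewrite -EFinB lee_fin; lra.
  by lra.
Qed.

(** The preservation properties are separate implications, so that one perturbation serves both
    ambient spaces. *)
Lemma far_from_simplified (S : probability (R3 R) R) (th : R) :
  simplified S -> 0 < th < 1 ->
  exists P : probability (R3 R) R,
    [/\ (TV S P <= th%:E)%E, is_copula3 S -> is_copula3 P,
        is_copula3 S -> ac_pos S -> ac_pos P &
        exists2 d : R, 0 < d & forall D, simplified D -> ~ (TV P D < d%:E)%E].
Proof.
move=> [K [SK _]] /andP[th0 th1].
pose Q1 : set (R2 R) := lower `*` II.
pose Q2 : set (R2 R) := II `*` lower.
pose Q : set (R2 R) := lower `*` lower.
have mlow : measurable lower by exact: measurable_itv.
have mI := @measurable_II R.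
have mQ1 : measurable Q1 by exact: measurableX.
have mQ2 : measurable Q2 by exact: measurableX.
have mQ : measurable Q by exact: measurableX.
pose k (Z : set (R2 R)) (t : RB R) := fine (K t Z).
have mk Z : measurable Z -> measurable_fun setT (k Z).
  by move=> mZ; exact: measurable_rcd SK mZ.
have k01 Z t : measurable Z -> 0 <= k Z t <= 1.
  by move=> mZ; exact: fine_prob01.
(* With [80] here and [100] in [d], the relative error [5 * eta + 5 * d / len B] of each final
   estimate is at most [th / 16 + th / 20 = 9 / 80 * th]; twice that stays below the gap
   [th / 4]. *)
pose eta := th / 80; have eta0 : 0 < eta by rewrite /eta; lra.
have shrink (A : set (RB R)) Z : measurable A -> A `<=` II -> (0 < leb A)%E ->
    measurable Z -> exists (A' : set (RB R)) (p : R),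
    [/\ measurable A', A' `<=` A, (0 < leb A')%E, 0 <= p <= 1 &
      forall t, A' t -> `|k Z t - p| <= eta].
  move=> mA AI A0 mZ.
  have [|t0 _ pos] := positive_level_set (mk _ mZ) _ mA eta0 A0.
    by move=> t _; exact: k01.
  exists (A `&` [set t | `|k Z t - k Z t0| <= eta]), (k Z t0); split.
  - by apply: measurableI => //; exact: measurable_fun_dist_le (mk _ mZ).
  - exact: subIsetl.
  - exact: pos.
  - exact: k01.
  - by move=> t [].
have I0 : (0 < leb II)%E by rewrite lebesgue_measure_II.
have [A1 [p1 [mA1 A1I A1pos p1I kA1]]] := shrink II Q1 mI (@subset_refl _ _) I0 mQ1.
have [A2 [p2 [mA2 A2A1 A2pos p2I kA2]]] := shrink A1 Q2 mA1 A1I A1pos mQ2.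
have A2I := subset_trans A2A1 A1I.
have [A [q [mA AA2 Apos qI kA]]] := shrink A2 Q mA2 A2I A2pos mQ.
have AI := subset_trans AA2 A2I.
have [B1 [B2 [mB1 mB2 B1A B2A [B12 b1 b2]]]] := split_positive mA AI Apos.
have B1I := subset_trans B1A AI.
have [P PE] := block_mixture_exists mB1 B1I S (ltW th0) (ltW th1).
exists P; split.
- by apply: block_mixture_TV PE => //; exact: ltW.
- exact: block_mixture_copula PE.
- by apply: block_mixture_ac_pos PE _ => //; exact: ltW.
have PF := block_mixture_fine B1I PE.
have Snear Z p (E : set (RB R)) : measurable Z -> measurable E -> E `<=` A ->
    (forall t, A t -> `|k Z t - p| <= eta) ->
    `|fine (S (Z `*` E)) - p * len E| <= eta * len E.
  move=> mZ mE EA kp; have EI := subset_trans EA AI.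
  rewrite (rcd_slice SK)//; apply: Rintegral_near_cst => //.
  - exact: mk.
  - by move=> t; exact: k01.
  - by move=> t /EA; exact: kp.
have len_ge0 (E : set (RB R)) : 0 <= len E by rewrite fine_ge0.
(* The distance [d] bounds absolute masses, so it has to be small relative to the length of both
   parts. *)
pose d := th * Num.min (len B1) (len B2) / 100.
have d0 : 0 < d by rewrite /d divr_gt0// mulr_gt0// lt_min b1.
exists d => // D sD PD.
have half01 : 0 <= (2^-1 : R) <= 1 by lra.
(* The function [a] depends on [D] alone; hence the same number [a r1 r2] will describe the box over
   [B1] and over [B2]. *)
have [a Ha] := simplified_box_mass sD half01 half01.
pose r1 := (1 - th) * p1 + th / 2; pose r2 := (1 - th) * p2 + th / 2.
have conv (p : R) : 0 <= p <= 1 -> 0 <= (1 - th) * p + th / 2 <= 1.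
  by move=> /andP[? ?]; apply/andP; split; nra.
have margin (Z : set (R2 R)) p (B E : set (RB R)) : measurable Z -> measurable B ->
    B `<=` A -> measurable E -> E `<=` B ->
    (forall t, A t -> `|k Z t - p| <= eta) ->
    fine (block_measure mB1 (Z `*` E)) = len E / 2 ->
    `|fine (D (Z `*` E)) - ((1 - th) * p + th / 2) * len E| <= eta * len B + d.
  move=> mZ mB BA mE EB kp bE.
  have EA := subset_trans EB BA.
  have mZE : measurable (Z `*` E) by exact: measurableX.
  have PD1 := TV_ltP PD mZE.
  have S1 := Snear Z p E mZ mE EA kp.
  have EBlen : len E <= len B.
    have BI' := subset_trans BA AI; have EI := subset_trans EA AI.
    by rewrite -lee_fin -!len_fineK//; apply: le_measure; rewrite ?inE.
  move: PD1; rewrite PF// bE.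
  have e1 : eta * len E <= eta * len B by rewrite ler_pM2l.
  move: S1; rewrite !(ler_norml, ltr_norml) => /andP[S1 S2] /andP[P1 P2].
  by apply/andP; split; nra.
(* Three errors add up, before division by [len B]: [4 * (eta * len B + d)] from the simplified form
   of [D], [d] from passing from [D] to [P], and at most [eta * len B] from replacing [k Q] by
   [q]. *)
have key (B : set (RB R)) (c : R) : measurable B -> B `<=` A -> 0 < len B ->
    d <= th * len B / 100 ->
    fine (block_measure mB1 (Q `*` B)) = c * len B ->
    `|a r1 r2 - ((1 - th) * q + th * c)| <= 9 / 80 * th.
  move=> mB BA lB dB bB; have BI := subset_trans BA AI.
  have D1 := Ha B r1 r2 (eta * len B + d) mB BI (conv _ p1I) (conv _ p2I).
  have {}D1 : `|fine (D (Q `*` B)) - a r1 r2 * len B| <= 4 * (eta * len B + d).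
    apply: D1 => E mE EB.
    - apply: margin => //; first by move=> t /AA2 /A2A1; exact: kA1.
      by rewrite block_measure_lower1//; exact: subset_trans BI.
    - apply: margin => //; first by move=> t /AA2; exact: kA2.
      by rewrite block_measure_lower2//; exact: subset_trans BI.
  have mQB : measurable (Q `*` B) by exact: measurableX.
  have PD1 := TV_ltP PD mQB.
  have S1 := Snear Q q B mQ mB BA kA.
  rewrite -(ler_pM2r lB) -[X in _ * X <= _](gtr0_norm lB) -normrM.
  move: PD1 S1 D1; rewrite PF// bB /eta.
  rewrite !(ler_norml, ltr_norml) => /andP[P1 P2] /andP[S1 S2] /andP[D1 D2].
  by apply/andP; split; nra.
have h1 : `|a r1 r2 - ((1 - th) * q + th * 2^-1)| <= 9 / 80 * th.
  apply: (key B1) => //.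
    by rewrite /d ler_pM2r// ler_pM2l// ge_min lexx.
  rewrite block_measure_lower12// setIid /=; by field.
have h2 : `|a r1 r2 - ((1 - th) * q + th * 4^-1)| <= 9 / 80 * th.
  apply: (key B2) => //.
    by rewrite /d ler_pM2r// ler_pM2l// ge_min lexx orbT.
  rewrite block_measure_lower12//; last exact: subset_trans AI.
  rewrite setIC B12 measure0 /=; by field.
(* The two centers differ by [th / 4], more than the sum [18 / 80 * th] of the radii. *)
move: h1 h2; rewrite !ler_norml => /andP[? ?] /andP[? ?].
by lra.
Qed.

(** The hypothesis on [X] says that it is stable under the perturbation. A ball inside the closure
    would contain a simplified [S] near its center, then a perturbation [P] of [S]; but [P] has a
    neighborhood without simplified copulas. *)
Lemma simplified_nowhere_dense (X : set (probability (R3 R) R)) :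
  (forall S P, X S -> (is_copula3 S -> is_copula3 P) ->
     (is_copula3 S -> ac_pos S -> ac_pos P) -> X P) ->
  nowhere_dense_TV X [set C | X C /\ simplified C].
Proof.
move=> XP; apply/seteqP; split=> // C [XC [e e0 Cint]].
have e4 : 0 < e / 4 by lra.
(* The center [C] lies in its own ball, hence in the closure. *)
have [|_ /(_ _ e4)[S [[XS sS] CS]]] := Cint C XC.
  apply: le_lt_trans (_ : (0 < e%:E)%E); last by rewrite lte_fin.
  by apply: TV_leP => G mG; rewrite subrr normr0.
pose th := Num.min (e / 4) 2^-1.
have th01 : 0 < th < 1.
  by rewrite /th lt_min e4 invr_gt0 ltr0n/= gt_min; apply/orP; right; lra.
have [P [SP cP aP [d d0 far]]] := far_from_simplified sS th01.
have XPP := XP S P XS cP aP.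
have [|_ /(_ _ d0)[D [[_ sD] PD]]] := Cint P XPP; last exact: (far D sD PD).
(* Bounding all events only yields a non-strict bound on the supremum, so the triangle inequality is
   run with [e / 4 + e / 2], strictly below [e]. *)
apply: (@le_lt_trans _ _ (3 * e / 4)%:E); last by rewrite lte_fin; lra.
apply: TV_leP => G mG.
have CS1 := TV_ltP CS mG.
have SP1 : `|fine (S G) - fine (P G)| < e / 2.
  apply: TV_ltP => //; apply: le_lt_trans SP _; rewrite lte_fin /th gt_min.
  by apply/orP; left; lra.
have := ler_normD (fine (C G) - fine (S G)) (fine (S G) - fine (P G)).
by rewrite addrA subrK; lra.
Qed.

End SimplifiedNowhereDense.

Theorem theorem3p10 (R : realType) :
  nowhere_dense_TV [set C | @is_copula3 R C]
    [set C | is_copula3 C /\ simplified C] /\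
  nowhere_dense_TV [set C | @is_copula3 R C /\ ac_pos C]
    [set C | (is_copula3 C /\ ac_pos C) /\ simplified C].
Proof.
split.
  by apply: simplified_nowhere_dense => S P XS cP _; exact: cP.
by apply: simplified_nowhere_dense => S P [cS aS] cP aP; split; [exact: cP|exact: aP].
Qed.
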